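(* Let $q$ be a prime power and let $C\subseteq \mathbb{F}_q^n$ be a nonzero linear code of length $n$, dimension $k$ and minimum distance $d$, with weight distribution $(A_0,\dots,A_n)$. If $C$ is MDS (so $d=n-k+1$), then $A_0=1$ and $$A_i=\binom{n}{i}(q-1)\sum_{m=0}^{i-d}\binom{i-1}{m}(-1)^m q^{\,i-d-m},\qquad d=n-k+1\le i\le n.$$ If $C$ is not MDS, let $d^\perp$ be the minimum distance of the dual code $C^\perp$. Then the weight distribution of $C$ is determined by $A_d,A_{d+1},\dots,A_{n-d^\perp}$; that is, if $C'\subseteq\mathbb{F}_q^n$ is another non-MDS linear code of the same dimension $k$, the same minimum distance $d$ and the same dual minimum distance $d^\perp$, with weight distribution $(A'_0,\dots,A'_n)$ satisfying $A'_i=A_i$ for $d\le i\le n-d^\perp$, then $A'_i=A_i$ for all $0\le i\le n$.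
   Context: A linear code of length $n$ over $\mathbb{F}_q$ is a linear subspace $C\subseteq\mathbb{F}_q^n$; its minimum distance is the smallest Hamming weight of a nonzero codeword, where the weight of a word is its number of nonzero coordinates. The weight distribution is $(A_0,\dots,A_n)$ with $A_i=\#\{c\in C:\mathrm{wt}(c)=i\}$. The dual $C^\perp$ is the orthogonal complement of $C$ with respect to the standard dot product on $\mathbb{F}_q^n$. An $[n,k,d]_q$-code is called MDS if it attains the Singleton bound, i.e. $d=n+1-k$. (If $C$ is nonzero and not MDS then $C^\perp\neq 0$, so $d^\perp$ is defined.) *)

(* Defs.v *)
From HB Require Import structures.
From mathcomp Require Import all_boot all_order all_algebra.
From mathcomp Require Import sesquilinear.

Set Implicit Arguments.
Unset Strict Implicit.
Unset Printing Implicit Defensive.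

Import Order.TTheory GRing.Theory Num.Theory.
Local Open Scope ring_scope.

Definition dotp (F : fieldType) (n : nat) (u v : 'rV[F]_n) : F :=
  \sum_(j < n) u 0 j * v 0 j.

Lemma dotp_bilinear (F : fieldType) (n : nat) :
  bilinear_for
    (GRing.Scale.Law.clone _ _ *%R _)
    (GRing.Scale.Law.clone _ _ (idfun \; *%R) _)
    (@dotp F n : 'rV[F]_n -> 'rV[F]_n -> F).
Proof.
split=> [w | w] a u v; rewrite /dotp /=.
- rewrite mulr_sumr -big_split; apply: eq_bigr => j _ /=.
  by rewrite !mxE mulrDl mulrA.
- rewrite mulr_sumr -big_split; apply: eq_bigr => j _ /=.
  by rewrite !mxE mulrDr mulrCA.
Qed.

HB.instance Definition _ (F : fieldType) (n : nat) :=
  bilinear_isBilinear.Build F 'rV[F]_n 'rV[F]_n F *%R (idfun \; *%R)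
    (@dotp F n) (dotp_bilinear F n).

Lemma dotp_symmetric (F : fieldType) (n : nat) (u v : 'rV[F]_n) :
  dotp u v = (-1) ^+ false * idfun (dotp v u).
Proof.
by rewrite expr0 mul1r; apply: eq_bigr => j _; rewrite mulrC.
Qed.

HB.instance Definition _ (F : fieldType) (n : nat) :=
  isHermitianSesquilinear.Build F 'rV[F]_n false idfun
    (@dotp F n) (@dotp_symmetric F n).

Definition dual_code (F : fieldType) (n : nat) (C : {vspace 'rV[F]_n}) :
    {vspace 'rV[F]_n} :=
  orthov (@dotp F n) C.

Lemma mem_dual_codeP (F : fieldType) (n : nat) (C : {vspace 'rV[F]_n})
    (u : 'rV[F]_n) :
  reflect {in C, forall v, dotp u v = 0} (u \in dual_code C).
Proof. exact: mem_orthovP. Qed.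

Definition wt (F : fieldType) (n : nat) (c : 'rV[F]_n) : nat :=
  #|[set j : 'I_n | c 0 j != 0]|.

(* Every weight is at most n, so the seed n of the minimum does not affect the
   value on a nonzero code; on the zero code the value n is a dummy. *)
Definition min_dist (F : finFieldType) (n : nat) (C : {vspace 'rV[F]_n}) : nat :=
  \big[minn/n]_(c : 'rV[F]_n | (c \in C) && (c != 0)) wt c.

Lemma wt_le (F : fieldType) (n : nat) (c : 'rV[F]_n) : (wt c <= n)%N.
Proof. by rewrite /wt -[leqRHS]card_ord max_card. Qed.

Lemma min_distP (F : finFieldType) (n : nat) (C : {vspace 'rV[F]_n}) (d : nat) :
  C != 0%VS ->
  min_dist C = d <->
  (exists c, [/\ c \in C, c != 0 & wt c = d]) /\
  (forall c, c \in C -> c != 0 -> (d <= wt c)%N).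
Proof.
move=> nzC.
have lower c : c \in C -> c != 0 -> (min_dist C <= wt c)%N.
  move=> cC cnz; rewrite /min_dist.
  have: c \in index_enum 'rV[F]_n by rewrite mem_index_enum.
  elim: (index_enum _) => [|x s IHs] //; rewrite inE big_cons => /predU1P[<-|cs].
    by rewrite cC cnz geq_minl.
  by case: ifP => _; [rewrite geq_min IHs ?orbT | apply: IHs].
have [c0 c0C c0nz] : exists2 c, c \in C & c != 0.
  by exists (vpick C); [exact: memv_pick | rewrite vpick0].
have attained : exists c, [/\ c \in C, c != 0 & wt c = min_dist C].
  have : min_dist C = n \/ exists c, [/\ c \in C, c != 0 & wt c = min_dist C].
    rewrite /min_dist; elim/big_ind: _ => [|x y Hx Hy|c /andP[cC cnz]].
    - by left.
    - by rewrite /minn; case: ifP.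
    - by right; exists c.
  case=> // Hn; exists c0; split=> //; apply/eqP.
  by rewrite eqn_leq lower // andbT Hn wt_le.
split=> [<- // | [[c [cC cnz <-]] mind]].
apply/eqP; rewrite eqn_leq lower //=.
by have [e [eC enz <-]] := attained; apply: mind.
Qed.

Definition weight_distr (F : finFieldType) (n : nat) (C : {vspace 'rV[F]_n})
    (i : nat) : nat :=
  #|[set c : 'rV[F]_n | (c \in C) && (wt c == i)]|.

Definition is_MDS (F : finFieldType) (n : nat) (C : {vspace 'rV[F]_n}) : Prop :=
  min_dist C = (n + 1 - \dim C)%N.

(* Main.v *)
(* Let Z_T be the space of words vanishing on the coordinate set T.  Counting
   pairs (T, c) with c in C vanishing on T, the numbers
   B_s = sum_(|T| = s) |C :&: Z_T| and the A_i are related by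
   B_s = sum_i A_i 'C(n - i, s), which binomial inversion solves for A.
   For an MDS code, dim (C :&: Z_T) = max(k - |T|, 0) for every T, which gives
   all B_s.  In general the same holds as soon as |T| < dperp, since a nonzero
   word orthogonal to C + Z_T would be a dual word supported in T; for
   s >= dperp, B_s only involves the A_i with i <= n - dperp. *)
Require Import Defs.
From mathcomp Require Import all_boot all_order all_algebra.
From mathcomp Require Import finfield zify ring.

Set Implicit Arguments.
Unset Strict Implicit.
Unset Printing Implicit Defensive.

Import Order.TTheory GRing.Theory Num.Theory.
Local Open Scope ring_scope.

(** * Binomial identities and binomial inversion *)

Lemma subn_eq_swap (n i j : nat) :
  (i <= n)%N -> (j <= n)%N -> (n - i == j)%N = (i == n - j)%N.
Proof. by move=> le_in le_jn; apply/eqP/eqP; lia. Qed.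

Lemma mul_bin_trinomial (n i m : nat) : (i <= n)%N -> (m <= i)%N ->
  ('C(n, m + (n - i)) * 'C(m + (n - i), n - i) = 'C(n, i) * 'C(i, m))%N.
Proof.
move=> le_in le_mi; have le_mn : (m + (n - i) <= n)%N by lia.
have fact1 := bin_fact le_mn; have fact2 := bin_fact (leq_addl m (n - i)).
have fact3 := bin_fact le_in; have fact4 := bin_fact le_mi.
have subE : (n - (m + (n - i)) = i - m)%N by lia.
rewrite subE in fact1; rewrite addnK in fact2.
apply/eqP; rewrite -(eqn_pmul2r (fact_gt0 (n - i))) -(eqn_pmul2r (fact_gt0 m)).
rewrite -(eqn_pmul2r (fact_gt0 (i - m))); apply/eqP.
transitivity (n`!); [rewrite -fact1 -fact2 | rewrite -fact3 -fact4]; ring.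
Qed.

Lemma PoszX (a m : nat) : (a ^ m)%N%:Z = a%:Z ^+ m.
Proof. by elim: m => // m IHm; rewrite expnS PoszM IHm exprS. Qed.

(** For [j > s] the exponent [s - j] truncates to 0, but the binomial coefficient vanishes there. *)
Lemma coef_Xsub1_exp (R : comNzRingType) (s j : nat) :
  (('X - 1) ^+ s : {poly R})`_j = (-1) ^+ (s - j) *+ 'C(s, j).
Proof.
rewrite addrC exprDn coef_sum.
under eq_bigr => i _ do
  rewrite coefMn -polyC1 -polyCN -polyC_exp coefCM coefXn eq_sym mulr_natr.
case: (leqP j s) => [le_js | lt_sj].
  rewrite (bigD1 (Ordinal (le_js : (j < s.+1)%N))) //= eqxx big1 ?addr0 //.
  by move=> i; rewrite -val_eqE /= => /negPf ->; rewrite mulr0n mul0rn.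
rewrite bin_small // big1 // => i _.
by rewrite (ltn_eqF (leq_ltn_trans _ lt_sj)) ?mulr0n ?mul0rn // -ltnS.
Qed.

Lemma binomial_inversion (R : comNzRingType) (n : nat) (a b : nat -> R) :
    (forall s, (s <= n)%N -> b s = \sum_(j < n.+1) a j *+ 'C(j, s)) ->
  forall j, (j <= n)%N ->
    a j = \sum_(s < n.+1) (-1) ^+ (s - j) * b s *+ 'C(s, j).
Proof.
move=> b_def j le_jn.
(* Expand X = (X - 1) + 1 in the generating polynomial of a. *)
have polyE : \sum_(i < n.+1) a i *: 'X^i =
    \sum_(s < n.+1) b s *: (('X - 1) ^+ s : {poly R}).
  under [RHS]eq_bigr => s _ do
    (rewrite b_def -1?ltnS // scaler_suml;
     under eq_bigr => i _ do rewrite -scalerMnl scalerMnr).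
  rewrite exchange_big /=; apply: eq_bigr => i _.
  rewrite -scaler_sumr; congr (_ *: _).
  rewrite -[in LHS](subrK 1 'X) exprD1n.
  rewrite -(big_mkord xpredT (fun s => ('X - 1) ^+ s *+ 'C(i, s))).
  rewrite -(big_mkord xpredT (fun s => ('X - 1) ^+ s *+ 'C(i, s))) /=.
  rewrite [RHS](big_cat_nat _ (n := i.+1)) //=.
  rewrite [X in _ = _ + X]big_nat [X in _ = _ + X]big1 ?addr0 // => s.
  by move=> /andP[lt_is _]; rewrite bin_small.
have /(congr1 (fun p : {poly R} => p`_j)) := polyE.
rewrite !coef_sum (bigD1 (Ordinal (le_jn : (j < n.+1)%N))) //=.
rewrite big1 ?addr0 => [|i neq_ij]; last first.
  rewrite coefZ coefXn eq_sym -val_eqE /= in neq_ij *.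
  by rewrite (negPf neq_ij) mulr0.
rewrite coefZ coefXn eqxx mulr1 => ->; apply: eq_bigr => s _.
by rewrite coefZ coef_Xsub1_exp mulrnAr mulrC.
Qed.

(* Pascal's rule; the terms with m > e cancel because both truncated exponents
   are then 0. *)
Lemma sum_truncated_geometric (R : comNzRingType) (q : R) (e i : nat) :
    (e < i)%N ->
  \sum_(m < i.+1) (-1) ^+ m * q ^+ (e.+1 - m) *+ 'C(i, m) =
  (q - 1) * \sum_(m < e.+1) (-1) ^+ m * q ^+ (e - m) *+ 'C(i.-1, m).
Proof.
case: i => // i; rewrite ltnS /= => le_ei.
have shift : \sum_(m < i.+2) (-1) ^+ m * q ^+ (e.+1 - m) *+ 'C(i.+1, m) =
    \sum_(m < i.+1) (-1) ^+ m * (q ^+ (e.+1 - m) - q ^+ (e - m)) *+ 'C(i, m).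
  rewrite big_ord_recl /= bin0.
  under eq_bigr => m _ do rewrite /bump /= add1n binS mulrnDr.
  rewrite big_split /= addrA.
  have -> : (-1) ^+ 0 * q ^+ (e.+1 - 0) *+ 1 +
     \sum_(m < i.+1) (-1) ^+ m.+1 * q ^+ (e.+1 - m.+1) *+ 'C(i, m.+1) =
     \sum_(m < i.+2) (-1) ^+ m * q ^+ (e.+1 - m) *+ 'C(i, m).
    by rewrite [RHS]big_ord_recl bin0.
  rewrite big_ord_recr /= bin_small // mulr0n addr0 -big_split /=.
  apply: eq_bigr => m _.
  by rewrite subSS exprS -mulrnDl -!mulrA mulN1r -mulrBr.
rewrite shift mulr_sumr.
rewrite -(big_mkord xpredT (fun m =>
  (-1) ^+ m * (q ^+ (e.+1 - m) - q ^+ (e - m)) *+ 'C(i, m))).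
rewrite -(big_mkord xpredT (fun m =>
  (q - 1) * ((-1) ^+ m * q ^+ (e - m) *+ 'C(i, m)))).
rewrite (big_cat_nat _ (n := e.+1)) //= [X in _ + X]big_nat [X in _ + X]big1.
  rewrite addr0 big_nat [RHS]big_nat; apply: eq_bigr => m /andP[_ lt_me].
  rewrite subSn // exprS -mulrnAr -[q ^+ _ in X in _ - X]mul1r -mulrBl.
  by rewrite -!mulrnAr mulrCA mulrnAr.
move=> m /andP[lt_em _].
by rewrite (eqP lt_em) (eqP (ltnW lt_em)) subrr mulr0 mul0rn.
Qed.

(** * Spaces of words vanishing on a set of coordinates *)

Section VanishingOn.
Variables (F : finFieldType) (n : nat).
Implicit Types (T : {set 'I_n}) (C U : {vspace 'rV[F]_n}) (c v : 'rV[F]_n).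

(** Given by spanning unit vectors, so that counting them bounds the dimension; [vanishingP]
    recovers the description by zeros. *)
Definition vanishing T : {vspace 'rV[F]_n} :=
  (\sum_(j in ~: T) <[delta_mx 0%R j]>)%VS.

Lemma card_leqn T : (#|T| <= n)%N.
Proof. by rewrite -[leqRHS]card_ord max_card. Qed.

Lemma dim_leqn U : (\dim U <= n)%N.
Proof. by have := dimvS (subvf U); rewrite dimvf /dim /= mul1n. Qed.

Lemma vanishingP T v : reflect {in T, forall j, v 0 j = 0} (v \in vanishing T).
Proof.
apply: (iffP idP) => [/memv_sumP[w w_in ->] j jT|v0].
  rewrite summxE big1 // => i; move=> iT; have /vlineP[a ->] := w_in i iT.
  rewrite !mxE eqxx /=; case: eqP => [ij|_]; last by rewrite mulr0.
  by rewrite inE -ij jT in iT.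
rewrite [v]row_sum_delta (bigID (mem T)) /= big1 ?add0r => [|j jT]; last first.
  by rewrite v0 // scale0r.
apply: memv_suml => j jT; apply: (subvP (sumv_sup j _ (subvv _))).
  by rewrite inE.
by rewrite memvZ // memv_line.
Qed.

(** The spanning vectors bound the dimension for [T] and for its complement. The two spaces together
    span everything and the two bounds add up to [n], so both are equalities. *)
Lemma dim_vanishing T : \dim (vanishing T) = (n - #|T|)%N.
Proof.
have le_dim (S : {set 'I_n}) : (\dim (vanishing S) <= n - #|S|)%N.
  have -> : (n - #|S| = \sum_(j in ~: S) 1)%N.
    by rewrite sum1_card; have := cardsC S; rewrite card_ord; lia.
  apply: leq_trans (dimv_sum_leqif _) _.
  by apply: leq_sum => j _; rewrite /= dim_vline leq_b1.
have full : (vanishing T + vanishing (~: T) = fullv)%VS.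
  apply/vspaceP => v; rewrite memvf; apply/memv_addP.
  exists (\row_j (v 0 j *+ (j \notin T))).
    by apply/vanishingP => j jT; rewrite mxE jT.
  exists (\row_j (v 0 j *+ (j \in T))).
    by apply/vanishingP => j; rewrite inE mxE => /negPf ->.
  by apply/rowP => j; rewrite !mxE; case: (j \in T); rewrite ?addr0 ?add0r.
have := dimv_sum_cap (vanishing T) (vanishing (~: T)).
have := cardsC T; rewrite full dimvf card_ord /dim /= mul1n.
have := le_dim T; have := le_dim (~: T).
by move: #|T| #|~: T| => t u; lia.
Qed.

Lemma dim_le_cap_vanishing U T : (\dim U <= \dim (U :&: vanishing T) + #|T|)%N.
Proof.
have := dimv_sum_cap U (vanishing T); rewrite dim_vanishing.
by have := dim_leqn (U + vanishing T); have := card_leqn T; lia.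
Qed.

(** Rank-nullity for the map [f] sending a word to its dot products with a basis of [U]: its kernel
    lies in the dual, and its image has dimension at most [\dim U]. *)
Lemma dim_dual_code_ge U : (n <= \dim U + \dim (dual_code U))%N.
Proof.
pose B := \matrix_(j, i) (vbasis U)`_i 0 j : 'M[F]_(n, \dim U).
pose f := linfun (mulmxr B : 'rV[F]_n -> 'rV[F]_(\dim U)).
have ker_dual : (lker f <= dual_code U)%VS.
  apply/subvP => v; rewrite memv_ker lfunE /= => /eqP vB0.
  apply/mem_dual_codeP => u /coord_vbasis ->.
  rewrite linear_sumr big1 // => i _; rewrite linearZr /=.
  have /rowP/(_ i) := vB0; rewrite !mxE => vBi.
  rewrite -[RHS](mulr0 (coord (vbasis U) i u)) -[in RHS]vBi; congr (_ * _).
  by apply: eq_bigr => j _; rewrite mxE.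
have := limg_ker_dim f fullv; rewrite capfv dimvf /dim /= mul1n.
have := dimvS ker_dual; have := dimvS (subvf (limg f)).
rewrite dimvf /dim /= mul1n => le_lim le_ker rank_nullity.
by rewrite -[leqLHS]rank_nullity addnC leq_add.
Qed.

(** * Dimension of a code cut by vanishing conditions *)

Lemma min_dist_le C c : c \in C -> c != 0 -> (min_dist C <= wt c)%N.
Proof.
move=> cC nz_c; have nzC : C != 0%VS.
  by apply: contraNneq nz_c => C0; rewrite C0 memv0 in cC.
by have [_ ->] := (min_distP (min_dist C) nzC).1 erefl.
Qed.

Lemma wt_vanishing T v : v \in vanishing T -> (wt v <= n - #|T|)%N.
Proof.
move=> /vanishingP v0; have := cardsC T; rewrite card_ord => nE.
suff : (wt v <= #|~: T|)%N by lia.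
by apply/subset_leq_card/subsetP => j; rewrite !inE; apply: contraNN => /v0/eqP.
Qed.

Lemma cap_vanishing_eq0 C T :
  (n - #|T| < min_dist C)%N -> (C :&: vanishing T = 0)%VS.
Proof.
move=> lt_d; apply/eqP; rewrite -subv0; apply/subvP => c.
rewrite memv_cap memv0 => /andP[cC /wt_vanishing wt_c].
by apply: contraTT lt_d => /(min_dist_le cC); lia.
Qed.

(** Each vanishing condition lowers the dimension by at most one, while [\dim C] conditions already
    leave only 0, because [n - \dim C] is less than the minimum distance. Hence up to that point
    every condition lowers it by exactly one. *)
Lemma dim_cap_vanishing_MDS C T :
  is_MDS C -> \dim (C :&: vanishing T) = (\dim C - #|T|)%N.
Proof.
rewrite /is_MDS => dE.
have dimC := dim_leqn C; have cardT := card_leqn T.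
case: (leqP (\dim C) #|T|) => [le_kT | lt_Tk].
  by rewrite cap_vanishing_eq0 ?dimv0 ?dE; lia.
(* [R] enlarges [T] to a set of exactly [\dim C] coordinates; it exists since [\dim C <= n]. *)
have [R] : exists R, R \in [set A : {set 'I_n} | A \subset ~: T &
                                   #|A| == (\dim C - #|T|)%N].
  apply/set0Pn; rewrite -card_gt0 cards_draws bin_gt0.
  by have := cardsC T; rewrite card_ord; lia.
rewrite inE => /andP[RT /eqP cardR].
have cardTR : #|T :|: R| = \dim C.
  have TR0 : T :&: R = set0.
    by apply/eqP; rewrite setI_eq0 disjoint_sym disjoints_subset.
  by rewrite cardsU TR0 cards0 cardR; lia.
have cap0 : (C :&: vanishing T :&: vanishing R = 0)%VS.
  apply/eqP; rewrite -subv0.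
  rewrite -(@cap_vanishing_eq0 C (T :|: R)) ?cardTR ?dE; last lia.
  apply/subvP => c; rewrite !memv_cap -andbA => /and3P[-> cT cR] /=.
  apply/vanishingP => j /setUP[jT | jR].
    by apply: (vanishingP _ _ cT).
  by apply: (vanishingP _ _ cR).
have := dim_le_cap_vanishing (C :&: vanishing T) R; rewrite cap0 dimv0 cardR.
have := dim_le_cap_vanishing C T; lia.
Qed.

Lemma dim_cap_vanishing_dual C T :
    (#|T| < min_dist (dual_code C))%N ->
  \dim (C :&: vanishing T) = (\dim C - #|T|)%N.
Proof.
move=> lt_dual; set U := (C + vanishing T)%VS.
have dualU0 : (dual_code U = 0)%VS.
  apply/eqP; rewrite -subv0; apply/subvP => v /mem_dual_codeP v_dual.
  rewrite memv0; apply: contraTT lt_dual => nz_v; rewrite -leqNgt.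
  have v_dualC : v \in dual_code C.
    by apply/mem_dual_codeP => c cC; apply/v_dual/(subvP (addvSl _ _)).
  apply: leq_trans (min_dist_le v_dualC nz_v) _.
  (* The unit vector at any [j] outside [T] vanishes on [T], so [v] is orthogonal to it and
     [v 0 j = 0]: the support of [v] lies in [T]. *)
  apply/subset_leq_card/subsetP => j; rewrite inE; apply: contraR => jT.
  have ej : delta_mx 0 j \in U.
    apply/(subvP (addvSr _ _))/vanishingP => i iT; rewrite mxE eqxx /=.
    by case: eqP => // ij; rewrite -ij iT in jT.
  have := v_dual _ ej; rewrite /dotp (bigD1 j) //= mxE !eqxx mulr1.
  rewrite big1 ?addr0 => [/eqP //|i /negPf ne_ij].
  by rewrite mxE ne_ij andbF mulr0.
(* A zero dual forces [U] to have dimension [n]; the formula for the dimension of a sum then yields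
   the intersection. *)
have := dim_dual_code_ge U; rewrite dualU0 dimv0 addn0 => dimU.
have := dimv_sum_cap C (vanishing T); rewrite dim_vanishing -/U.
by have := card_leqn T; have := dim_leqn U; lia.
Qed.

(** * From counts of shortened codes to the weight distribution *)

(** Double counting: a codeword with exactly [j] zeros, that is of weight [n - j], vanishes on
    ['C(j, s)] of the sets of size [s]. *)
Lemma sum_card_cap_vanishing C s :
  \sum_(T : {set 'I_n} | #|T| == s) #|(C :&: vanishing T)%VS| =
  (\sum_(j < n.+1) weight_distr C (n - j) * 'C(j, s))%N.
Proof.
under eq_bigr => T _ do rewrite -sum1_card.
rewrite (exchange_big_dep [in C]) /=; last first.
  by move=> T c _; rewrite memv_cap => /andP[].
pose zeros c := inord (n - wt c) : 'I_n.+1.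
rewrite (partition_big zeros predT) //=; apply: eq_bigr => j _.
rewrite /weight_distr -sum1_card big_distrl /=.
apply: eq_big => [c | c /andP[cC /eqP <-]].
  rewrite inE -val_eqE /= inordK ?ltnS ?leq_subr //.
  by congr (_ && _); exact: subn_eq_swap (wt_le c) (leq_ord j).
rewrite mul1n inordK ?ltnS ?leq_subr //.
have -> : 'C(n - wt c, s) =
    #|[set T : {set 'I_n} | T \subset ~: [set j | c 0 j != 0] & #|T| == s]|.
  by rewrite cards_draws cardsCs setCK card_ord.
rewrite -sum1_card; apply: eq_bigl => T.
rewrite inE memv_cap cC andbC /=; congr (_ && _).
apply/vanishingP/subsetP => [c0 i iT | c0 i /c0].
  by rewrite !inE negbK c0.
by rewrite !inE negbK => /eqP.
Qed.

(** Binomial inversion indexed by the number of zeros, at [j = n - i]; the signs require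
    integers. *)
Lemma weight_distrE C i : (i <= n)%N ->
  (weight_distr C i)%:Z =
  \sum_(s < n.+1) (-1) ^+ (s - (n - i)) *
     (\sum_(T : {set 'I_n} | #|T| == s) #|(C :&: vanishing T)%VS|)%N%:Z
       *+ 'C(s, n - i).
Proof.
move=> le_in; pose a j := (weight_distr C (n - j))%:Z.
pose b s := (\sum_(T : {set 'I_n} | #|T| == s) #|(C :&: vanishing T)%VS|)%N%:Z.
have := @binomial_inversion int n a b _ _ (leq_subr i n).
rewrite /a subKn //; apply=> s _.
rewrite /b sum_card_cap_vanishing -[LHS]intz sumMz.
by apply: eq_bigr => j _; rewrite intz PoszM -mulr_natr natz.
Qed.

(** * The MDS formula and the determination by middle weights *)

Lemma weight_distr0 C : weight_distr C 0 = 1%N.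
Proof.
rewrite /weight_distr -[RHS](cards1 (0 : 'rV[F]_n)); apply: eq_card => c.
rewrite !inE /wt cards_eq0; apply/andP/eqP => [[_ /eqP supp0] | ->].
  apply/rowP => j; rewrite mxE; apply/eqP.
  by have := in_set0 j; rewrite -supp0 inE => /negbFE.
by rewrite mem0v; split=> //; apply/eqP/setP => j; rewrite !inE mxE eqxx.
Qed.

Lemma weight_distr_lt_min_dist C i :
  (0 < i < min_dist C)%N -> weight_distr C i = 0%N.
Proof.
move=> /andP[i_gt0 lt_id]; apply/eqP; rewrite cards_eq0; apply/eqP/setP => c.
rewrite !inE; apply/andP => -[cC /eqP wt_c].
suff : c != 0 by move=> /(min_dist_le cC); rewrite wt_c leqNgt lt_id.
apply: contraTneq i_gt0 => c0; rewrite -wt_c c0 /wt -leqNgt leqn0 cards_eq0.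
by apply/eqP/setP => j; rewrite !inE mxE eqxx.
Qed.

Lemma sum_card_cap_vanishing_const C s m :
    (forall T, #|T| = s -> \dim (C :&: vanishing T) = m) ->
  \sum_(T : {set 'I_n} | #|T| == s) #|(C :&: vanishing T)%VS| =
  ('C(n, s) * #|F| ^ m)%N.
Proof.
move=> dim_m.
under eq_bigr => T /eqP cardT do rewrite card_vspace dim_m //.
rewrite sum_nat_cond_const; congr (_ * _)%N.
by rewrite -[n in RHS]card_ord -card_draws; apply: eq_card => T; rewrite !inE.
Qed.

Lemma weight_distr_MDS C i :
    is_MDS C -> (min_dist C <= i <= n)%N ->
  (weight_distr C i)%:Z = 'C(n, i)%:Z * (#|F|%:Z - 1) *
    \sum_(0 <= m < (i - min_dist C).+1)
      'C(i.-1, m)%:Z * (-1) ^+ m * #|F|%:Z ^+ (i - min_dist C - m)%N.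
Proof.
move=> mdsC /andP[le_di le_in]; rewrite weight_distrE //.
(* Positivity of the distance gives [e < i] below, as the truncated geometric sum requires. *)
have dimC := dim_leqn C; have d_gt0 : (0 < min_dist C)%N by rewrite mdsC; lia.
set e := (i - min_dist C)%N.
have dimE : (\dim C - (n - i) = e.+1)%N.
  by rewrite /e; move: mdsC; rewrite /is_MDS; lia.
have shortenedE s :
    \sum_(T : {set 'I_n} | #|T| == s) #|(C :&: vanishing T)%VS| =
    ('C(n, s) * #|F| ^ (\dim C - s))%N.
  by apply: sum_card_cap_vanishing_const => T <-; rewrite dim_cap_vanishing_MDS.
under eq_bigr => s _ do rewrite shortenedE.
rewrite -(big_mkord xpredT (fun s => (-1) ^+ (s - (n - i)) *
  ('C(n, s) * #|F| ^ (\dim C - s))%N%:Z *+ 'C(s, n - i))).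
(* Terms with [s < n - i] vanish; the others are reindexed by [s = m + (n - i)], which turns the
   exponent of [#|F|] into [e.+1 - m]. *)
rewrite (big_cat_nat _ (n := (n - i)%N)) ?leqW ?leq_subr //=.
rewrite [X in X + _]big_nat [X in X + _]big1 ?add0r => [|s /andP[_ lt_s]];
  last by rewrite (bin_small lt_s).
rewrite -{1}[(n - i)%N]add0n big_addn.
have -> : (n.+1 - (n - i) = i.+1)%N by lia.
rewrite -mulrA big_mkord.
under [X in _ * (_ * X)]eq_bigr => m _ do
  rewrite [_ * (-1) ^+ m]mulrC mulrAC -[Posz 'C(_, _)]natz mulr_natr.
rewrite [X in _ * (_ * X)]big_mkord -sum_truncated_geometric; last first.
  by rewrite /e; lia.
rewrite mulr_sumr; apply: eq_bigr => m _; have le_mi := leq_ord m.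
rewrite addnK subnDA subnAC dimE.
have /(congr1 Posz) := mul_bin_trinomial le_in le_mi.
rewrite !PoszM !pmulrn !mulrzz PoszX => trinomial.
by rewrite (mulrC 'C(n, _)%:Z) mulrA -[LHS]mulrA trinomial mulrCA.
Qed.

(** The inversion formulas of the two codes agree term by term: for [s < dperp] the inner sum
    depends only on [\dim C], and for [s >= dperp] only on weights at most [n - dperp]. *)
Lemma eq_weight_distr C C' d dperp :
    \dim C' = \dim C -> min_dist C = d -> min_dist C' = d ->
    min_dist (dual_code C) = dperp -> min_dist (dual_code C') = dperp ->
    (forall i, (d <= i <= n - dperp)%N ->
       weight_distr C' i = weight_distr C i) ->
  forall i, (i <= n)%N -> weight_distr C' i = weight_distr C i.
Proof.
move=> eq_dim dC dC' dpC dpC' eq_low i le_in; apply/eqP; rewrite -eqz_nat.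
rewrite !weight_distrE //; apply/eqP/eq_bigr => s _; congr (_ * Posz _ *+ _).
have [lt_s | le_s] := ltnP s dperp.
  have shortenedE (D : {vspace 'rV[F]_n}) :
      \dim D = \dim C -> min_dist (dual_code D) = dperp ->
      \sum_(T : {set 'I_n} | #|T| == s) #|(D :&: vanishing T)%VS| =
      ('C(n, s) * #|F| ^ (\dim C - s))%N.
    move=> dimD dpD; apply: sum_card_cap_vanishing_const => T cardT.
    by rewrite dim_cap_vanishing_dual ?dimD cardT // dpD.
  by rewrite !shortenedE.
rewrite !sum_card_cap_vanishing; apply: eq_bigr => j _.
(* Only [j >= s >= dperp] contributes, so the weight [n - j] is 0, strictly between 0 and [d], or in
   the range where the distributions agree by hypothesis. *)
have [lt_js | le_sj] := ltnP j s; first by rewrite bin_small ?muln0.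
congr (_ * _)%N; have [-> | nz_nj] := eqVneq (n - j)%N 0%N.
  by rewrite !weight_distr0.
have [lt_d | le_d] := ltnP (n - j) d.
  by rewrite !weight_distr_lt_min_dist ?dC ?dC' ?lt_d ?lt0n ?nz_nj.
by apply: eq_low; rewrite le_d leq_sub2l // (leq_trans le_s).
Qed.

End VanishingOn.

Theorem theorem2 (q n k d : nat) (F : finFieldType) (hq : #|F| = q)
    (C : {vspace 'rV[F]_n}) (hC : C != 0%VS)
    (hk : \dim C = k) (hd : min_dist C = d) :
  (is_MDS C ->
     weight_distr C 0 = 1%N /\
     forall i : nat, (d <= i <= n)%N ->
       (weight_distr C i)%:Z =
         'C(n, i)%:Z * (q%:Z - 1) *
         \sum_(0 <= m < (i - d).+1)
            'C(i.-1, m)%:Z * (-1) ^+ m * q%:Z ^+ (i - d - m)%N)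
  /\
  (~ is_MDS C ->
     forall dperp : nat, min_dist (dual_code C) = dperp ->
     forall C' : {vspace 'rV[F]_n},
       ~ is_MDS C' ->
       \dim C' = k ->
       min_dist C' = d ->
       min_dist (dual_code C') = dperp ->
       (forall i : nat, (d <= i <= n - dperp)%N ->
          weight_distr C' i = weight_distr C i) ->
       forall i : nat, (i <= n)%N -> weight_distr C' i = weight_distr C i).
Proof.
subst q k d; split=> [mdsC | _ dperp dpC C' _ eq_dim dC' dpC' eq_low i le_in].
  by split=> [|i le_din]; [exact: weight_distr0 | exact: weight_distr_MDS].
exact: eq_weight_distr eq_dim erefl dC' dpC dpC' eq_low i le_in.
Qed.
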